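(* Let $\mathbf{k}$ be an algebraically closed field, $R=\mathbf{k}[\![x_1,\dots,x_n]\!]$, and let $A=R/I$ be an Artin ring with $\mathrm{gcl}(A)=1$. Let $h=\dim_{\mathbf{k}}\mathcal{L}_{A,1}$ and let $\mathfrak a\subset\mathbf{k}[a_1,\dots,a_h]$ be the ideal of minors defined in the context. Then $$MGC(A)=\mathbb{P}_{\mathbf{k}}^{h-1}\setminus\mathbb{V}_+(\mathfrak a).$$ Moreover, for any non-Gorenstein Artin ring $A=R/I$ (with $\mathfrak a$ defined in the same way), $\mathrm{gcl}(A)=1$ if and only if $\mathfrak a\neq 0$.
   Context: $\mathfrak m$ is the maximal ideal of $R$ and $S=\mathbf{k}[y_1,\dots,y_n]$ is an $R$-module by contraction: $x^\alpha\circ y^\beta=y^{\beta-\alpha}$ if $\beta\ge\alpha$ componentwise and $0$ otherwise. $I^\perp=\{G\in S: I\circ G=0\}$, $\langle F\rangle=R\circ F$, $\mathrm{Ann}_R F=\{f\in R: f\circ F=0\}$, and $\int_K M=\{G\in S: K\circ G\subset M\}$ for an ideal $K$ of $R$ and an $R$-submodule $M\subset S$. $\ell$ denotes length. $G=R/\mathrm{Ann}_RF$ is a Gorenstein cover of $A=R/I$ if $I^\perp\subset\langle F\rangle$; $\mathrm{gcl}(A)=\min\{\ell(G)-\ell(A)\}$ over all Gorenstein covers; a cover is minimal if it attains this minimum. $\mathcal{L}_{A,1}=\int_{\mathfrak m}I^\perp/I^\perp$. Setting: $A$ is non-Gorenstein, of socle degree $s$ (the largest $i$ with $\mathfrak m^i\not\subset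 I$). Following the paper's convention for colength at most $2$, $A=R/I$ is presented with $n=\dim R$ equal to the embedding dimension of $A$. Fix a $\mathbf{k}$-basis $b_1,\dots,b_t$ of $I^\perp$ and polynomials $F_1,\dots,F_h\in\int_{\mathfrak m}I^\perp$ whose classes form a $\mathbf{k}$-basis of $\mathcal{L}_{A,1}$. With indeterminate coefficients put $F=\sum_{j=1}^h a_jF_j$. For each $\alpha\in\mathbb{N}^n$ with $1\le|\alpha|\le s+1$ write $x^\alpha\circ F=\sum_{j=1}^t\mu_\alpha^j b_j$, where the $\mu^j_\alpha$ are linear forms in $a_1,\dots,a_h$. $\mathfrak a$ is the homogeneous ideal of $\mathbf{k}[a_1,\dots,a_h]$ generated by all minors of order $t$ of the matrix $(\mu_\alpha^j)_{1\le|\alpha|\le s+1,\,1\le j\le t}$. $\mathbb{P}_{\mathbf{k}}(\mathcal{L}_{A,1})$ is identified with $\mathbb{P}_{\mathbf{k}}^{h-1}$ via the coordinates $(a_1:\dots:a_h)$, and $\mathbb{V}_+(\mathfrak a)$ is the set of zeros of $\mathfrak a$ in it. For $\mathrm{gcl}(A)=1$, $MGC(A)\subset\mathbb{P}_{\mathbf{k}}^{h-1}$ is the set of points $[a_1:\dots:a_h]$ such that, for $F=\sum_j a_jF_j$, $R/\mathrm{Ann}_RF$ is a minimal Gorenstein cover of $A$. *)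

(* Defs.v *)
From HB Require Import structures.
From mathcomp Require Import all_boot all_order all_algebra.
From mathcomp Require Import boolp classical_sets.
From mathcomp Require Import mpoly.

Set Implicit Arguments.
Unset Strict Implicit.
Unset Printing Implicit Defensive.

Import GRing.Theory.

Local Open Scope classical_set_scope.
Local Open Scope ring_scope.

(* Formal power series K[[x_1, .., x_n]], given by their coefficients. *)

Record fps (K : Type) (n : nat) := Fps { fps_coef :> 'X_{1..n} -> K }.

HB.instance Definition _ (K : Type) (n : nat) := gen_eqMixin (fps K n).
HB.instance Definition _ (K : Type) (n : nat) := gen_choiceMixin (fps K n).

Section FpsRing.
Context (K : comNzRingType) (n : nat).
Implicit Types f g : fps K n.

Lemma fpsP f g : (forall m, f m = g m) -> f = g.
Proof. by case: f g => [f] [g] /= /funext ->. Qed.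

Definition fps_zero : fps K n := Fps (fun=> 0).
Definition fps_one : fps K n := Fps (fun m => (m == 0%MM)%:R).
Definition fps_opp f : fps K n := Fps (fun m => - f m).
Definition fps_add f g : fps K n := Fps (fun m => f m + g m).
Definition fps_scale (c : K) f : fps K n := Fps (fun m => c * f m).
Definition fps_mul f g : fps K n :=
  Fps (fun m => \sum_(p : 'X_{1..n < (mdeg m).+1} | (p <= m)%MM)
                  f p * g (m - p)%MM).

Lemma fps_addA : associative fps_add.
Proof. by move=> f g l; apply: fpsP => m /=; rewrite addrA. Qed.
Lemma fps_addC : commutative fps_add.
Proof. by move=> f g; apply: fpsP => m /=; rewrite addrC. Qed.
Lemma fps_add0 : left_id fps_zero fps_add.
Proof. by move=> f; apply: fpsP => m /=; rewrite add0r. Qed.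
Lemma fps_addN : left_inverse fps_zero fps_opp fps_add.
Proof. by move=> f; apply: fpsP => m /=; rewrite addNr. Qed.

HB.instance Definition _ :=
  GRing.isZmodule.Build (fps K n) fps_addA fps_addC fps_add0 fps_addN.

(* The ring axioms are transported from {mpoly K[n]} by truncation. *)
Definition fps_trunc (d : nat) f : {mpoly K[n]} :=
  \sum_(p : 'X_{1..n < d}) f p *: 'X_[p].

Lemma fps_truncE d f m : (mdeg m < d)%N -> (fps_trunc d f)@_m = f m.
Proof.
move=> lt_md; rewrite /fps_trunc raddf_sum /=.
rewrite (bigD1 (BMultinom lt_md)) //= mcoeffZ mcoeffX eqxx mulr1.
rewrite big1 ?addr0 // => p neq_pm; rewrite mcoeffZ mcoeffX.
by move: neq_pm; rewrite eqE /= => /negbTE ->; rewrite mulr0.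
Qed.

Lemma fps_mulE d f g m : (mdeg m < d)%N ->
  (fps_mul f g) m = (fps_trunc d f * fps_trunc d g)@_m.
Proof.
move=> lt_md; rewrite [RHS](mcoeff_poly_mul_lin _ _ (ltnSn (mdeg m))) /=.
apply: eq_bigr => p le_pm; rewrite !fps_truncE //.
  exact: leq_ltn_trans (mdegB _ _) lt_md.
by case: p le_pm => p /= lt_p _; rewrite (leq_trans lt_p).
Qed.

Lemma fps_mul_trunc d f g (p q : {mpoly K[n]}) m : (mdeg m < d)%N ->
  (forall m', (mdeg m' < d)%N -> f m' = p@_m') ->
  (forall m', (mdeg m' < d)%N -> g m' = q@_m') ->
  (fps_mul f g) m = (p * q)@_m.
Proof.
move=> lt_md fp gq; rewrite [RHS](mcoeff_poly_mul_lin _ _ (ltnSn (mdeg m))) /=.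
apply: eq_bigr => r le_rm; rewrite fp ?gq //.
  exact: leq_ltn_trans (mdegB _ _) lt_md.
by case: r le_rm => r /= lt_r _; rewrite (leq_trans lt_r).
Qed.

Lemma fps_mulA : associative fps_mul.
Proof.
move=> f g l; apply: fpsP => m; set d := (mdeg m).+1.
have tr (u : fps K n) m' : (mdeg m' < d)%N -> u m' = (fps_trunc d u)@_m'.
  by move=> lt; rewrite fps_truncE.
rewrite (@fps_mul_trunc d f _ (fps_trunc d f) (fps_trunc d g * fps_trunc d l))
  ?ltnSn //; [| exact: tr | by move=> m'; exact: fps_mulE].
rewrite (@fps_mul_trunc d _ l (fps_trunc d f * fps_trunc d g) (fps_trunc d l))
  ?ltnSn ?mulrA //; [by move=> m'; exact: fps_mulE | exact: tr].
Qed.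

Lemma fps_mulC : commutative fps_mul.
Proof.
move=> f g; apply: fpsP => m.
by rewrite !(fps_mulE _ _ (ltnSn (mdeg m))) mulrC.
Qed.

Lemma fps_mul1 : left_id fps_one fps_mul.
Proof.
move=> f; apply: fpsP => m.
rewrite (@fps_mul_trunc (mdeg m).+1 _ _ 1 (fps_trunc (mdeg m).+1 f)) //.
- by rewrite mul1r fps_truncE.
- by move=> m' _; rewrite mcoeff1.
by move=> m' lt; rewrite fps_truncE.
Qed.

Lemma fps_mulDl : left_distributive fps_mul fps_add.
Proof.
move=> f g l; apply: fpsP => m /=; rewrite -big_split /=.
by apply: eq_bigr => p _; rewrite mulrDl.
Qed.

Lemma fps_one_neq0 : fps_one != 0.
Proof.
apply/eqP => /(congr1 (fun f : fps K n => f 0%MM)) /=.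
by rewrite eqxx => /eqP; rewrite oner_eq0.
Qed.

HB.instance Definition _ := GRing.Zmodule_isComNzRing.Build (fps K n)
  fps_mulA fps_mulC fps_mul1 fps_mulDl fps_one_neq0.

Lemma fps_scaleA a b f : fps_scale a (fps_scale b f) = fps_scale (a * b) f.
Proof. by apply: fpsP => m /=; rewrite mulrA. Qed.
Lemma fps_scale1 : left_id 1 fps_scale.
Proof. by move=> f; apply: fpsP => m /=; rewrite mul1r. Qed.
Lemma fps_scaleDr : right_distributive fps_scale +%R.
Proof. by move=> c f g; apply: fpsP => m /=; rewrite mulrDr. Qed.
Lemma fps_scaleDl f : {morph fps_scale^~ f : a b / a + b}.
Proof. by move=> a b; apply: fpsP => m /=; rewrite mulrDl. Qed.

HB.instance Definition _ := GRing.Zmodule_isLmodule.Build K (fps K n)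
  fps_scaleA fps_scale1 fps_scaleDr fps_scaleDl.

Definition fpsX (al : 'X_{1..n}) : fps K n := Fps (fun m => (m == al)%:R).

(* The maximal ideal of K[[x_1, .., x_n]] when K is a field. *)
Definition fps_max : set (fps K n) := [set f | f 0%MM = 0].

(* The action determined by x^al o y^be = y^(be - al) if al <= be and 0
   otherwise; only the al <= be with be in the support of G contribute. *)
Definition contract (f : fps K n) (G : {mpoly K[n]}) : {mpoly K[n]} :=
  \sum_(be <- msupp G)
    \sum_(al : 'X_{1..n < (mdeg be).+1} | (al <= be)%MM)
      (f al * G@_be) *: 'X_[be - al].

Lemma contractX (al be : 'X_{1..n}) :
  contract (fpsX al) 'X_[be] = if (al <= be)%MM then 'X_[be - al] else 0.
Proof.
rewrite /contract msuppX big_seq1 mcoeffX eqxx.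
case: ifP => [le_ab | nle_ab]; last first.
  apply: big1 => p le_pb /=; case: eqP => [eq_pa|_].
    by rewrite -eq_pa le_pb in nle_ab.
  by rewrite mul0r scale0r.
have lt_ab : (mdeg al < (mdeg be).+1)%N.
  by rewrite ltnS -(submK le_ab) mdegD leq_addl.
rewrite (bigD1 (BMultinom lt_ab)) //= eqxx mulr1 scale1r big1 ?addr0 // => p.
by case/andP=> _; rewrite eqE /= => /negbTE ->; rewrite mul0r scale0r.
Qed.

End FpsRing.

Section Ideals.
Context (R : comNzRingType).
Implicit Types I J : set R.

Definition is_ideal I : Prop :=
  [/\ I 0, forall x y, I x -> I y -> I (x + y) & forall r x, I x -> I (r * x)].

Definition ideal_gen (X : set R) : set R :=
  [set x | exists (m : nat) (c y : 'I_m -> R),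
     (forall i, X (y i)) /\ x = \sum_(i < m) c i * y i].

Definition ideal_add I J : set R := [set x + y | x in I & y in J].

Definition ideal_pow I (i : nat) : set R :=
  ideal_gen [set x | exists y : 'I_i -> R,
    (forall j, I (y j)) /\ x = \prod_(j < i) y j].

Definition ideal_colon I J : set R := [set x | forall y, J y -> I (x * y)].

Definition artinian_quot I : Prop :=
  forall J : nat -> set R,
    (forall i, is_ideal (J i) /\ I `<=` J i) ->
    (forall i, J i.+1 `<=` J i) ->
    exists N : nat, forall i, (N <= i)%N -> J i = J N.

(* Submodules of R/I are ideals of R containing I. *)
Definition quot_chain I (l : nat) : Prop :=
  exists J : nat -> set R,
    (forall i, (i <= l)%N -> is_ideal (J i) /\ I `<=` J i) /\
    (forall i, (i < l)%N -> J i `<` J i.+1).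

(* R/I has length l as an R-module. *)
Definition quot_length I (l : nat) : Prop :=
  quot_chain I l /\ forall l', quot_chain I l' -> (l' <= l)%N.

End Ideals.

(* The classes of the v i form a basis of V/W. *)
Definition quot_basis (K : fieldType) (E : lmodType K) (V W : set E)
    (d : nat) (v : 'I_d -> E) : Prop :=
  [/\ forall i, V (v i),
      forall x, V x -> exists c : 'I_d -> K, W (x - \sum_(i < d) c i *: v i)
    & forall c : 'I_d -> K, W (\sum_(i < d) c i *: v i) -> forall i, c i = 0].

Definition quot_dim (K : fieldType) (E : lmodType K) (V W : set E)
    (d : nat) : Prop :=
  exists v : 'I_d -> E, quot_basis V W v.

Section Inverse.
Context (k : fieldType) (n : nat).
Local Notation R := (fps k n).
Local Notation S := {mpoly k[n]}.
Local Notation mm := (@fps_max k n).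
Implicit Types (I : set R) (F : S).

Definition perp I : set S := [set G | forall f, I f -> contract f G = 0].
Definition cyclic_sub F : set S := [set contract f F | f in [set: R]].
Definition annihilator F : set R := [set f | contract f F = 0].
Definition integral (K : set R) (M : set S) : set S :=
  [set G | forall f, K f -> M (contract f G)].

(* dim_k m_A / m_A^2 for A = R/I and m_A = m/I. *)
Definition embdim I (d : nat) : Prop :=
  quot_dim (ideal_add mm I) (ideal_add (ideal_pow mm 2) I) d.

Definition socle_degree I (s : nat) : Prop :=
  ~ (ideal_pow mm s `<=` I) /\
  forall i, ~ (ideal_pow mm i `<=` I) -> (i <= s)%N.

(* For R/I Artinian: the socle (I : m)/I is one-dimensional. *)
Definition gorenstein I : Prop := quot_dim (ideal_colon I mm) I 1.

Definition gor_cover I F : Prop := perp I `<=` cyclic_sub F.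

(* l(R/Ann F) - l(R/I) = c *)
Definition cover_colength I F (c : nat) : Prop :=
  exists l, quot_length I l /\ quot_length (annihilator F) (l + c).

Definition is_gcl I (c : nat) : Prop :=
  (exists F, gor_cover I F /\ cover_colength I F c) /\
  forall F d, gor_cover I F -> cover_colength I F d -> (c <= d)%N.

Definition min_gor_cover I F : Prop :=
  gor_cover I F /\ exists c, cover_colength I F c /\ is_gcl I c.

End Inverse.

Section Projective.
Context (k : fieldType).

(* The points of the projective (h-1)-space are the lines of k^h. *)
Definition proj (h : nat) := {L : {vspace 'rV[k]_h} | \dim L == 1%N}.

(* P = [a_1 : .. : a_h] *)
Definition hcoord h (P : proj h) (a : 'rV[k]_h) : Prop :=
  a != 0 /\ a \in val P.

Definition Vplus h (J : set {mpoly k[h]}) : set (proj h) :=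
  [set P | forall a, hcoord P a -> forall f, J f -> f.@[a 0] = 0].

Definition MGC n (I : set (fps k n)) h (F : 'I_h -> {mpoly k[n]}) :
    set (proj h) :=
  [set P | exists2 a, hcoord P a & min_gor_cover I (\sum_(j < h) a 0 j *: F j)].

(* sum_j a_j F_j with indeterminate coefficients a_1, .., a_h. *)
Definition generic_comb n h (F : 'I_h -> {mpoly k[n]}) :
    {mpoly {mpoly k[h]}[n]} :=
  \sum_(j < h) ('X_j : {mpoly k[h]}) *: map_mpoly (@mpolyC h k) (F j).

(* The ideal generated by the minors of order t of the matrix with t columns
   and rows mu al, for 1 <= |al| <= d; the rows of a minor are listed in an
   arbitrary order, which only affects its sign. *)
Definition minors_ideal n h t (d : nat)
    (mu : 'X_{1..n} -> 'I_t -> {mpoly k[h]}) : set {mpoly k[h]} :=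
  ideal_gen [set x | exists r : 'I_t -> 'X_{1..n},
    [/\ injective r, forall i, (1 <= mdeg (r i) <= d)%N
      & x = \det (\matrix_(i < t, j < t) mu (r i) j)]].

End Projective.

(* Main.v *)
(* An F is a Gorenstein cover of colength 1 exactly when the maximal submodule
   m o F of <F> is the perp of I: the perp of I is then a submodule of
   codimension 1 of the cyclic module <F>, which has only one. Such an F lies in
   the integral of the perp of I, and by Nakayama only its class modulo the perp
   of I matters, so F may be taken of the form sum_j a_j F_j. Since m^(s+2)
   kills F, m o F is spanned by the x^al o F with 1 <= |al| <= s+1, and it fills
   the perp of I iff some minor of order t does not vanish at a. A nonzero ideal
   of minors has such a point a because k is infinite. Finally a cover of
   colength 0 makes A Gorenstein. Lengths are computed as ranks, in the
   coordinates given by the monomials of degree < d for d large. *)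
Require Import Defs.
From HB Require Import structures.
From mathcomp Require Import all_boot all_order all_algebra.
From mathcomp Require Import boolp classical_sets.
From mathcomp Require Import mpoly.

Set Implicit Arguments.
Unset Strict Implicit.
Unset Printing Implicit Defensive.

Import GRing.Theory.

Local Open Scope classical_set_scope.
Local Open Scope ring_scope.

(** * The contraction action of power series on polynomials *)

Section Contraction.
Context (K : comNzRingType) (n : nat).
Local Notation R := (fps K n).
Local Notation S := {mpoly K[n]}.
Implicit Types (f g : R) (F G : S) (m al : 'X_{1..n}).

Lemma sum_bmultinom_eq (V : nmodType) d m (H : 'X_{1..n} -> V) (P : pred 'X_{1..n}) :
  (mdeg m < d)%N ->
  (forall al, P al -> al = m) ->
  \sum_(al : 'X_{1..n < d} | P al) H al = if P m then H m else 0.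
Proof.
move=> lt_md Pm; case: ifP => Pm'; last first.
  by apply: big1 => al Pal; move: (Pal); rewrite (Pm _ Pal) Pm'.
rewrite (bigD1 (BMultinom lt_md)) //= big1 ?addr0 // => al /andP[/Pm eq_al].
by rewrite bmeqP /= eq_al eqxx.
Qed.

(** The exponents [be] of [G] that reach [m] are those of the form [al + m]. Leaving [d] free gives
    polynomials of different sizes a common index range, on which additivity in [G] is termwise. *)
Lemma mcoeff_contract d f G m : (msize G <= d)%N ->
  (contract f G)@_m = \sum_(al : 'X_{1..n < d}) f al * G@_(al + m).
Proof.
move=> le_Gd.
transitivity (\sum_(be <- msupp G)
    if (m <= be)%MM then f (be - m)%MM * G@_be else 0).
  rewrite /contract raddf_sum /=; apply: eq_bigr => be _.
  rewrite raddf_sum /= (eq_bigr (fun al : 'X_{1..n < (mdeg be).+1} =>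
    if (be - al)%MM == m then f al * G@_be else 0)); last first.
    by move=> al _; rewrite mcoeffZ mcoeffX; case: eqP; rewrite ?mulr1 ?mulr0.
  rewrite -big_mkcondr.
  rewrite (@sum_bmultinom_eq _ _ (be - m)%MM (fun al => f al * G@_be)
    (fun al => (al <= be)%MM && ((be - al)%MM == m))).
  - rewrite lem_subr /=; case: ifP => [/eqP <-|].
      by rewrite lem_subr.
    case: ifP => // le_m; rewrite submBA // addmC addmK eqxx //.
  - by rewrite ltnS mdegB.
  by move=> al /andP[le_al /eqP <-]; rewrite submBA // addmC addmK.
rewrite (eq_bigr (fun al : 'X_{1..n < d} => \sum_(be <- msupp G)
    if be == (al + m)%MM then f al * G@_be else 0)); last first.
  move=> al _; rewrite -big_mkcond; have [|] := boolP ((al + m)%MM \in msupp G).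
    by move=> al_supp; rewrite -big_filter filter_pred1_uniq ?msupp_uniq ?big_seq1.
  move=> al_supp; rewrite (memN_msupp_eq0 al_supp) mulr0 big_seq_cond big1 //.
  by move=> be /andP[be_supp /eqP eq_be]; rewrite -eq_be be_supp in al_supp.
rewrite exchange_big /= big_seq [RHS]big_seq; apply: eq_bigr => be be_supp.
rewrite -big_mkcond /=.
rewrite (@sum_bmultinom_eq _ _ (be - m)%MM (fun al => f al * G@_be)
    (fun al => be == (al + m)%MM)).
- case: ifP => [le_m|]; first by rewrite submK // eqxx.
  by case: ifP => // /eqP -> /negP[]; exact: lem_addl.
- apply: leq_ltn_trans (mdegB _ _) _; exact: leq_trans (msize_mdeg_lt be_supp) le_Gd.
by move=> al /eqP ->; rewrite addmK.
Qed.

Lemma mcoeff_contractX al G m : (contract (fpsX K al) G)@_m = G@_(al + m).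
Proof.
pose d := maxn (msize G) (mdeg al).+1.
rewrite (@mcoeff_contract d) ?leq_maxl //=.
rewrite (eq_bigr (fun be : 'X_{1..n < d} =>
    if (be : 'X_{1..n}) == al then G@_(be + m) else 0)); last first.
  by move=> be _; case: eqP; rewrite ?mul1r ?mul0r.
rewrite -big_mkcond (@sum_bmultinom_eq _ _ al (fun be => G@_(be + m)) (pred1 al)) ?inE /= ?eqxx //.
  by rewrite leq_maxr.
by move=> be /eqP.
Qed.

Lemma mcoeff_ge_msize G m : (msize G <= mdeg m)%N -> G@_m = 0.
Proof. by move=> le_Gm; apply: memN_msupp_eq0; apply: msize_mdeg_ge. Qed.

Lemma msize_leP d G : (forall m, (d <= mdeg m)%N -> G@_m = 0) -> (msize G <= d)%N.
Proof.
move=> G0; rewrite msizeE; apply/bigmax_leqP_seq => m m_supp _.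
rewrite ltnNge; apply/negP => /G0 /eqP.
by rewrite mcoeff_eq0 m_supp.
Qed.

Lemma msize_contract f G : (msize (contract f G) <= msize G)%N.
Proof.
apply: msize_leP => m le_m; rewrite (mcoeff_contract _ _ (leqnn _)).
apply: big1 => al _; rewrite mcoeff_ge_msize ?mulr0 // mdegD.
exact: leq_trans le_m (leq_addl _ _).
Qed.

Lemma contractDr f : {morph contract f : F G / F + G}.
Proof.
move=> F G; apply/mpolyP => m; pose d := maxn (msize F) (msize G).
have le_FGd : (msize (F + G) <= d)%N by exact: msizeD_le.
rewrite mcoeffD !(@mcoeff_contract d) ?leq_maxl ?leq_maxr //.
by rewrite -big_split; apply: eq_bigr => al _; rewrite mcoeffD mulrDr.
Qed.

Lemma contract0r f : contract f (0 : S) = 0.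
Proof. by apply: (addrI (contract f 0)); rewrite -contractDr !addr0. Qed.

Lemma contractNr f G : contract f (- G) = - contract f G.
Proof. by apply/(addrI (contract f G)); rewrite -contractDr !subrr contract0r. Qed.

Lemma contractZr f c G : contract f (c *: G) = c *: contract f G.
Proof.
apply/mpolyP => m; rewrite mcoeffZ !(@mcoeff_contract (msize G)) ?msizeZ_le //.
by rewrite mulr_sumr; apply: eq_bigr => al _; rewrite mcoeffZ mulrCA.
Qed.

Lemma contract_sumr (J : Type) (r : seq J) (P : pred J) f (F : J -> S) :
  contract f (\sum_(i <- r | P i) F i) = \sum_(i <- r | P i) contract f (F i).
Proof. exact: (big_morph _ (contractDr f) (contract0r f)). Qed.

Lemma contractDl f g G : contract (f + g) G = contract f G + contract g G.
Proof.
apply/mpolyP => m; rewrite mcoeffD !(mcoeff_contract _ _ (leqnn _)) -big_split.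
by apply: eq_bigr => al _; rewrite mulrDl.
Qed.

Lemma contract0l G : contract (0 : R) G = 0.
Proof. by apply: (addrI (contract 0 G)); rewrite -contractDl !addr0. Qed.

Lemma contractZl c f G : contract (c *: f) G = c *: contract f G.
Proof.
apply/mpolyP => m; rewrite mcoeffZ !(mcoeff_contract _ _ (leqnn _)) mulr_sumr.
by apply: eq_bigr => al _; rewrite mulrA.
Qed.

Lemma contractNl f G : contract (- f) G = - contract f G.
Proof.
apply/mpolyP => m; rewrite mcoeffN !(mcoeff_contract _ _ (leqnn _)) -sumrN.
by apply: eq_bigr => al _; rewrite mulNr.
Qed.

Lemma fpsXM al g m :
  (fpsX K al * g) m = if (al <= m)%MM then g (m - al)%MM else 0.
Proof.
rewrite /GRing.mul /=.
have [le_al|nle_al] := boolP (al <= m)%MM.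
  transitivity (\sum_(p : 'X_{1..n < (mdeg m).+1} | (p : 'X_{1..n}) == al) g (m - p)%MM).
    rewrite [LHS]big_mkcond [RHS]big_mkcond; apply: eq_bigr => p _ /=.
    by case: eqP => [->|_]; rewrite ?le_al ?mul1r // mul0r if_same.
  rewrite (@sum_bmultinom_eq _ _ al (fun p => g (m - p)%MM) (pred1 al)) /= ?eqxx //.
    by rewrite ltnS -(submK le_al) mdegD leq_addl.
  by move=> p /eqP.
apply: big1 => p le_p; case: eqP => [eq_p|_]; last by rewrite mul0r.
by rewrite eq_p (negbTE nle_al) in le_p.
Qed.

(** Only coefficients in degrees below the size of [G] act, so both series may be replaced by their
    truncations. Bilinearity then reduces the claim to monomials. *)
Lemma contractM f g G : contract (f * g) G = contract f (contract g G).
Proof.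
apply/mpolyP => m; pose d := msize G.
have le_gG : (msize (contract g G) <= d)%N by exact: msize_contract.
rewrite (mcoeff_contract _ _ (leqnn _)) (mcoeff_contract _ _ le_gG) -/d.
(* [L p] is the coefficient of [p o G] at [m], viewed as a linear form in the polynomial [p]. *)
pose L (p : S) := \sum_(al : 'X_{1..n < d}) p@_al * G@_(al + m).
have LZ c p : L (c *: p) = c * L p.
  by rewrite mulr_sumr; apply: eq_bigr => al _; rewrite mcoeffZ mulrA.
have Lsum (J : finType) (p : J -> S) : L (\sum_j p j) = \sum_j L (p j).
  rewrite exchange_big; apply: eq_bigr => al _.
  by rewrite raddf_sum mulr_suml.
have LX c : L 'X_[c] = G@_(c + m).
  rewrite /L (eq_bigr (fun al : 'X_{1..n < d} =>
    if (al : 'X_{1..n}) == c then G@_(al + m) else 0)); last first.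
    by move=> al _; rewrite mcoeffX eq_sym; case: eqP; rewrite ?mul1r ?mul0r.
  rewrite -big_mkcond; have [lt_cd|le_dc] := ltnP (mdeg c) d.
    rewrite (@sum_bmultinom_eq _ _ c (fun al => G@_(al + m)) (pred1 c)) //=.
      by rewrite eqxx.
    by move=> al /eqP.
  (* For an exponent of degree at least [d], the coefficient of [G] vanishes and the sum has no
     matching index, so both sides are 0. *)
  rewrite mcoeff_ge_msize ?mdegD ?(leq_trans le_dc) ?leq_addr //.
  by apply: big1 => al /eqP eq_al; rewrite -eq_al leqNgt bmdeg in le_dc.
transitivity (L (fps_trunc d f * fps_trunc d g)).
  by apply: eq_bigr => al _; rewrite -fps_mulE ?bmdeg.
rewrite /fps_trunc mulr_suml (Lsum _ (fun i => _ * _)); apply: eq_bigr => al _.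
rewrite (mcoeff_contract _ _ (leqnn _)) -scalerAl LZ [X in L X]mulr_sumr (Lsum _ (fun i => _ * _)) -/d.
congr (_ * _); apply: eq_bigr => be _.
by rewrite -scalerAr LZ -mpolyXD LX addmA [(be + al)%MM]addmC.
Qed.

End Contraction.

(** * Powers of the maximal ideal, and a Nakayama lemma for contraction *)

Section Order.
Context (k : fieldType) (n : nat).
Local Notation R := (fps k n).
Local Notation S := {mpoly k[n]}.
Local Notation mm := (@fps_max k n).
Implicit Types (f g : R) (F G : S) (m al : 'X_{1..n}) (I J : set R).

Lemma contract1 G : contract (1 : R) G = G.
Proof.
have -> : 1 = fpsX k 0%MM :> R by [].
by apply/mpolyP => m; rewrite mcoeff_contractX add0m.
Qed.

Lemma fpsXD al be : fpsX k (al + be)%MM = fpsX k al * fpsX k be :> R.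
Proof.
apply: fpsP => m; rewrite fpsXM /=.
case: ifP => [le_al|nle_al]; last first.
  by case: eqP => // eq_m; rewrite eq_m lem_addr in nle_al.
congr (_%:R); congr nat_of_bool; apply/eqP/eqP => [->|<-].
  by rewrite addmC addmK.
by rewrite addmC submK.
Qed.

Lemma mdegS_decomp m d : mdeg m = d.+1 ->
  exists i m', m = (U_(i) + m')%MM /\ mdeg m' = d.
Proof.
move=> deg_m.
have [i m_i] : exists i, m i != 0%N.
  apply/existsP; rewrite -negb_forall; apply/negP => /forallP m0.
  suff : m = 0%MM by move=> m_eq0; rewrite m_eq0 mdeg0 in deg_m.
  by apply/mnmP => i; rewrite mnm0E; apply/eqP.
have le_im : (U_(i) <= m)%MM.
  by apply/mnm_lepP => j; rewrite mnm1E; case: eqP => // <-; rewrite lt0n.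
exists i, (m - U_(i))%MM; rewrite addmC submK //; split=> //.
by apply/eqP; rewrite -eqSS -deg_m -{2}(submK le_im) mdegD mdeg1 addn1.
Qed.

Lemma fpsX_pow d al : mdeg al = d -> ideal_pow mm d (fpsX k al).
Proof.
move=> deg_al.
suff [y [y_m eq_y]] : exists y : nat -> R,
    (forall j, mm (y j)) /\ fpsX k al = \prod_(j < d) y j.
  exists 1%N, (fun=> 1), (fun=> fpsX k al); rewrite big_ord1 mul1r; split=> // _.
  by exists (fun j : 'I_d => y j).
elim: d al deg_al => [|d IHd] al.
  move=> /eqP; rewrite mdeg_eq0 => /eqP ->.
  by exists (fun=> 0); rewrite big_ord0.
move=> /mdegS_decomp [i [al' [-> /IHd [y [y_m eq_y]]]]].
exists (fun j => if j is j'.+1 then y j' else fpsX k U_(i)).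
split=> [[|j]|]; first by rewrite /fps_max /= eq_sym mnm1_eq0.
  exact: y_m.
by rewrite big_ord_recl fpsXD eq_y.
Qed.

(** This is the power m^d, described by coefficients. *)
Definition fps_tail d : set R := [set f | forall m, (mdeg m < d)%N -> f m = 0].

(** Each monomial of [f] is charged to a single variable dividing it, so nothing is counted twice.
    Division by that variable lowers the order by at most one. *)
Lemma fps_tail1_decomp f : f 0%MM = 0 ->
  exists2 g : 'I_n -> R, f = \sum_i fpsX k U_(i) * g i &
    forall d, fps_tail d.+1 f -> forall i, fps_tail d (g i).
Proof.
move=> f0.
exists (fun i => Fps (fun m =>
  if [pick j | (m + U_(i))%MM j != 0%N] == Some i then f (m + U_(i))%MM else 0)).
  apply: fpsP => m.
  transitivity (\sum_i if [pick j | m j != 0%N] == Some i then f m else 0).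
    case: pickP => [i m_i|m0].
      rewrite (bigD1 i) //= eqxx big1 ?addr0 // => j ne_ji.
      by case: eqP => // -[eq_ij]; rewrite eq_ij eqxx in ne_ji.
    rewrite big1 //; suff -> : m = 0%MM by [].
    by apply/mnmP => i; rewrite mnm0E; apply/eqP; move: (m0 i) => /negbFE.
  rewrite (big_morph (fun g : R => g m) (id1 := 0) (op1 := +%R)) //.
  apply: eq_bigr => i _; rewrite fpsXM.
  have [le_im|nle_im] := boolP (U_(i) <= m)%MM; first by rewrite /= submK.
  case: pickP => // j m_j; case: eqP => // -[eq_ji].
  case/negP: nle_im; apply/mnm_lepP => l; rewrite mnm1E.
  by case: eqP => // <-; rewrite lt0n -eq_ji.
move=> d tail_f i m lt_md /=; case: ifP => // _; apply: tail_f.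
by rewrite mdegD mdeg1 addn1.
Qed.

Lemma fps_scaleAl (c : k) f g : c *: (f * g) = c *: f * g.
Proof.
apply: fpsP => m; rewrite /GRing.scale /GRing.mul /= mulr_sumr.
by apply: eq_bigr => p _; rewrite mulrA.
Qed.

Lemma idealZ I (c : k) f : is_ideal I -> I f -> I (c *: f).
Proof. by case=> _ _ IM If; rewrite -[f]mul1r fps_scaleAl; exact: IM. Qed.

Lemma ideal_sum I (X : Type) (r : seq X) (y : X -> R) :
  is_ideal I -> (forall i, I (y i)) -> I (\sum_(i <- r) y i).
Proof. by case=> I0 ID _ Iy; elim/big_ind : _ => //; exact: ID. Qed.

(** A series of order [d] is an infinite sum of monomials, so linearity alone does not suffice.
    Induction on [d] writes it as a finite sum of [x_i * g_i] and applies the hypothesis to [g_i]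
    and the colon ideal of [I] by [x_i]. *)
Lemma fps_tail_sub I d : is_ideal I ->
  (forall al, mdeg al = d -> I (fpsX k al)) -> fps_tail d `<=` I.
Proof.
elim: d I => [|d IHd] I I_id I_X f tail_f.
  have [_ _ IM] := I_id; rewrite -[f]mulr1; apply: IM.
  by apply: (I_X 0%MM); rewrite mdeg0.
have [|g eq_f tail_g] := @fps_tail1_decomp f; first by apply: tail_f; rewrite mdeg0.
rewrite eq_f; apply: ideal_sum => // i.
have [I0 ID IM] := I_id.
apply: (IHd [set g | I (fpsX k U_(i) * g)]).
- split=> [|x y Ix Iy|r x Ix] /=.
  + by rewrite mulr0.
  + by rewrite mulrDr; exact: ID.
  by rewrite mulrCA; exact: IM.
- by move=> al deg_al /=; rewrite -fpsXD; apply: I_X; rewrite mdegD mdeg1 deg_al.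
exact: tail_g.
Qed.

Lemma fps_tail_le d e : (d <= e)%N -> fps_tail e `<=` fps_tail d.
Proof. by move=> le_de f tail_f m lt_md; apply: tail_f; apply: leq_trans lt_md le_de. Qed.

Lemma socle_degree_tail I s : is_ideal I -> socle_degree I s ->
  fps_tail s.+1 `<=` I.
Proof.
move=> I_id [_ max_s].
have sub_I : ideal_pow mm s.+1 `<=` I.
  by apply: contrapT => /max_s; rewrite ltnn.
by apply: fps_tail_sub => // al deg_al; apply: sub_I; exact: fpsX_pow.
Qed.

Lemma contract_tail d f G : fps_tail d f -> (msize G <= d)%N -> contract f G = 0.
Proof.
move=> tail_f le_Gd; apply/mpolyP => m; rewrite (mcoeff_contract _ _ le_Gd) mcoeff0.
by apply: big1 => al _; rewrite tail_f ?mul0r // bmdeg.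
Qed.

Lemma fps_maxM_tail d f g : mm f -> fps_tail d g -> fps_tail d.+1 (f * g).
Proof.
move=> f0 tail_g m; rewrite ltnS => le_md; rewrite /GRing.mul /=.
apply: big1 => -[p lt_p] /= le_pm; have [->|p_neq0] := eqVneq p 0%MM.
  by rewrite f0 mul0r.
rewrite tail_g ?mulr0 //; apply: leq_trans le_md.
have := congr1 mdeg (submK le_pm); rewrite mdegD => <-.
by rewrite -{1}[mdeg (m - p)]addn0 ltn_add2l lt0n mdeg_eq0.
Qed.

Lemma msize_contract_max f G : mm f -> G != 0 -> (msize (contract f G) < msize G)%N.
Proof.
move=> f0 G_neq0; have := G_neq0; rewrite -msize_poly_eq0.
case eq_G : (msize G) => [|d] // _; rewrite ltnS; apply: msize_leP => m le_dm.
rewrite (mcoeff_contract _ _ (leqnn _)); apply: big1 => -[al lt_al] _ /=.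
have [->|al_neq0] := eqVneq al 0%MM; first by rewrite f0 mul0r.
rewrite mcoeff_ge_msize ?mulr0 // eq_G mdegD -add1n leq_add // lt0n.
by rewrite mdeg_eq0.
Qed.

(** Contraction by [g] strictly lowers the size of a nonzero [F], and [g o F] satisfies the same
    hypothesis as [F], since [M] is stable under contraction. Induction on the size puts [g o F] in
    [M], hence [F] too. *)
Lemma contract_nakayama (M : set S) g F :
  (forall x y, M x -> M y -> M (x + y)) ->
  M 0 -> (forall f x, M x -> M (contract f x)) ->
  mm g -> M (F - contract g F) -> M F.
Proof.
move=> MD M0 Mc g0; move: {2}(msize F) (leqnn (msize F)) => e.
elim: e F => [|e IHe] F le_Fe MF.
  by move: le_Fe; rewrite leqn0 msize_poly_eq0 => /eqP ->.
have [->//|F_neq0] := eqVneq F 0.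
rewrite -[F](subrK (contract g F)); apply: MD => //.
apply: IHe.
  by rewrite -ltnS; apply: leq_trans le_Fe; exact: msize_contract_max.
by rewrite -contractNr -contractDr; exact: Mc.
Qed.

End Order.

(** * Ideals containing all series of order at least d, as row spaces *)

Lemma mxrank_adds_row (K : fieldType) D (v : 'rV[K]_D) (M : 'M[K]_D) :
  ~~ (v <= M)%MS -> \rank (v + M)%MS = (\rank M).+1.
Proof.
move=> v_notin; apply/eqP; rewrite eqn_leq; apply/andP; split.
  apply: leq_trans (mxrank_adds_leqif _ _) _.
  by apply: (@leq_add _ _ 1) => //; exact: rank_leq_row.
have [le_rk eq_rk] := mxrank_leqif_sup (addsmxSr v M).
by rewrite ltn_neqAle le_rk andbT eq_rk addsmx_sub (negbTE v_notin).
Qed.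

(** Take a matrix of maximal rank among those whose row space lies in [P]: a vector of [P] outside
    the row space could be added to it and would raise the rank. *)
Lemma mx_of_subspace (K : fieldType) D (P : set 'rV[K]_D) :
  P 0 -> (forall u v, P u -> P v -> P (u + v)) ->
  (forall c v, P v -> P (c *: v)) ->
  exists M : 'M[K]_D, forall v, P v <-> (v <= M)%MS.
Proof.
move=> P0 PD PZ.
pose Q r := `[< exists M : 'M[K]_D, \rank M = r /\ forall v, (v <= M)%MS -> P v >].
have exQ : exists r, Q r.
  exists 0%N; apply/asboolP; exists 0; split; first by rewrite mxrank0.
  by move=> v; rewrite submx0 => /eqP ->.
have ubQ r : Q r -> (r <= D)%N by move=> /asboolP[M [<- _]]; exact: rank_leq_row.
case: (ex_maxnP exQ ubQ) => r /asboolP[M [rk_M sub_M]] max_r.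
exists M => v; split; last exact: sub_M.
move=> Pv; apply: contraT => /mxrank_adds_row rk_vM.
suff /max_r : Q r.+1 by rewrite ltnn.
apply/asboolP; exists (v + M)%MS; split; first by rewrite rk_vM rk_M.
move=> w /sub_addsmxP[[a b] /= ->]; apply: PD; last by apply/sub_M/submxMl.
by rewrite [a]mx11_scalar mul_scalar_mx; exact: PZ.
Qed.

Section Coordinates.
Context (k : fieldType) (n d : nat).
Local Notation R := (fps k n).
Local Notation S := {mpoly k[n]}.
Local Notation mm := (@fps_max k n).
Local Notation D := #|{: 'X_{1..n < d}}|.
Implicit Types (f g : R) (F G : S) (m al : 'X_{1..n}) (I J : set R).

Definition mono (i : 'I_D) : 'X_{1..n} := enum_val i.

Lemma mdeg_mono i : (mdeg (mono i) < d)%N.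
Proof. exact: bmdeg. Qed.

Lemma mono_inj : injective mono.
Proof. by move=> i j /val_inj /enum_val_inj. Qed.

Lemma mono_onto m : (mdeg m < d)%N -> exists i, mono i = m.
Proof.
by move=> lt_md; exists (enum_rank (BMultinom lt_md)); rewrite /mono enum_rankK.
Qed.

Lemma sum_mono (V : nmodType) (H : 'X_{1..n} -> V) :
  \sum_(al : 'X_{1..n < d}) H al = \sum_i H (mono i).
Proof. by rewrite (reindex _ (onW_bij _ (@enum_val_bij _))). Qed.

(** Applied to a series, this is its class modulo m^d; on polynomials of size at most [d] it is
    injective. *)
Definition vec (c : 'X_{1..n} -> k) : 'rV[k]_D := \row_i c (mono i).
Definition pvec F := vec (fun m => F@_m).

Lemma vecP (c e : 'X_{1..n} -> k) :
  vec c = vec e <-> (forall m, (mdeg m < d)%N -> c m = e m).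
Proof.
split=> [/rowP eq_ce m /mono_onto [i <-]|eq_ce].
  by have := eq_ce i; rewrite !mxE.
by apply/rowP => i; rewrite !mxE eq_ce ?mdeg_mono.
Qed.

Lemma vec_fpsD f g : vec (f + g : R) = vec f + vec g.
Proof. by apply/rowP => i; rewrite !mxE. Qed.
Lemma vec_fpsZ c f : vec (c *: f : R) = c *: vec f.
Proof. by apply/rowP => i; rewrite !mxE. Qed.
Lemma vec_fps_eq0 f : vec f = 0 <-> fps_tail d f.
Proof.
have -> : (0 : 'rV[k]_D) = vec (0 : R) by apply/rowP => i; rewrite !mxE.
exact: vecP.
Qed.

Lemma pvecD F G : pvec (F + G) = pvec F + pvec G.
Proof. by apply/rowP => i; rewrite !mxE mcoeffD. Qed.
Lemma pvecZ c F : pvec (c *: F) = c *: pvec F.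
Proof. by apply/rowP => i; rewrite !mxE mcoeffZ. Qed.
Lemma pvec0 : pvec 0 = 0.
Proof. by apply/rowP => i; rewrite !mxE mcoeff0. Qed.
Lemma pvec_sum (J : Type) (r : seq J) (P : pred J) (F : J -> S) :
  pvec (\sum_(i <- r | P i) F i) = \sum_(i <- r | P i) pvec (F i).
Proof. exact: (big_morph _ pvecD pvec0). Qed.

Lemma pvec_inj F G : (msize F <= d)%N -> (msize G <= d)%N ->
  pvec F = pvec G -> F = G.
Proof.
move=> le_Fd le_Gd /vecP eq_FG; apply/mpolyP => m.
have [/eq_FG //|le_dm] := ltnP (mdeg m) d.
by rewrite !mcoeff_ge_msize // (leq_trans _ le_dm).
Qed.

Lemma pvec_onto (v : 'rV[k]_D) : exists2 F, (msize F <= d)%N & pvec F = v.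
Proof.
exists (\sum_i v 0 i *: 'X_[mono i]).
  apply: msize_leP => m le_dm; rewrite raddf_sum big1 // => i _ /=.
  rewrite mcoeffZ mcoeffX; case: eqP => [eq_m|_]; last by rewrite mulr0.
  by move: (mdeg_mono i); rewrite eq_m ltnNge le_dm.
apply/rowP => i; rewrite !mxE raddf_sum (bigD1 i) //= mcoeffZ mcoeffX eqxx mulr1.
rewrite big1 ?addr0 // => j ne_ji; rewrite mcoeffZ mcoeffX.
by rewrite (inj_eq mono_inj) (negbTE ne_ji) mulr0.
Qed.

Lemma vec_onto (v : 'rV[k]_D) : exists f : R, vec f = v.
Proof.
by have [F _ <-] := pvec_onto v; exists (Fps (fun m => F@_m)).
Qed.

(** The kernel of [vec] is [fps_tail d], which lies in [J]; so [J] is the full preimage of its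
    image, which is a subspace. *)
Lemma ideal_mx J : is_ideal J -> fps_tail d `<=` J ->
  exists M : 'M[k]_D, forall f, J f <-> (vec f <= M)%MS.
Proof.
move=> J_id tail_J; have [J0 JD _] := J_id.
have JZ c f : J f -> J (c *: f) by exact: idealZ.
have [|||M eq_M] := @mx_of_subspace k D [set v | exists2 f, J f & vec f = v].
- exists 0 => //; exact/vec_fps_eq0.
- by move=> _ _ [f Jf <-] [g Jg <-]; exists (f + g); [exact: JD | exact: vec_fpsD].
- by move=> c _ [f Jf <-]; exists (c *: f); [exact: JZ | exact: vec_fpsZ].
exists M => f; split=> [Jf|/eq_M [g Jg eq_gf]]; first by apply/eq_M; exists f.
rewrite -[f](subrK g); apply: JD => //; apply: tail_J; apply/vec_fps_eq0.
by rewrite -scaleN1r vec_fpsD vec_fpsZ eq_gf scaleN1r subrr.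
Qed.

(** Along a chain the ranks start at [\rank M] or above, grow by at least one at each step, and
    never exceed [D]. *)
Lemma ideal_chain_le J (M : 'M[k]_D) l : fps_tail d `<=` J ->
  (forall f, J f <-> (vec f <= M)%MS) -> quot_chain J l -> (l <= D - \rank M)%N.
Proof.
move=> tail_J eq_M [C [C_id C_lt]].
have CM i : (i <= l)%N -> exists N : 'M[k]_D, forall f, C i f <-> (vec f <= N)%MS.
  by move=> le_il; have [Ci sub_C] := C_id i le_il; apply: ideal_mx => // f /tail_J /sub_C.
suff rk_ge i : (i <= l)%N -> forall N : 'M[k]_D,
    (forall f, C i f <-> (vec f <= N)%MS) -> (\rank M + i <= \rank N)%N.
  have [N eq_N] := CM l (leqnn l).
  have := rk_ge l (leqnn l) N eq_N.
  by move=> /leq_trans /(_ (rank_leq_row N)) le_D; rewrite leq_subRL ?rank_leq_row.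
elim: i => [|i IHi] le_il N eq_N.
  rewrite addn0; apply: mxrankS; apply/row_subP => j.
  have [f eq_f] := vec_onto (row j M).
  rewrite -eq_f; apply/eq_N; have [_ sub_C] := C_id 0%N le_il.
  by apply/sub_C/eq_M; rewrite eq_f row_sub.
have [P eq_P] := CM i (ltnW le_il).
have le_rkP := IHi (ltnW le_il) P eq_P.
have [sub_C nsub_C] := C_lt i le_il.
rewrite addnS; apply: leq_ltn_trans le_rkP _; rewrite ltnNge; apply/negP => le_NP.
have sub_PN : (P <= N)%MS.
  apply/row_subP => j; have [f eq_f] := vec_onto (row j P).
  by rewrite -eq_f; apply/eq_N/sub_C/eq_P; rewrite eq_f row_sub.
apply: nsub_C => f /eq_N sub_f; apply/eq_P; apply: submx_trans sub_f _.
by rewrite -(mxrank_leqif_sup sub_PN) eqn_leq le_NP mxrankS.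
Qed.

(** A nonzero socle element of R/J. Going down from [d], stop at the first power m^e not contained
    in [J] and take [f] in m^e outside [J]; then m f lies in m^(e+1), hence in [J]. *)
Lemma ideal_step J : is_ideal J -> fps_tail d `<=` J -> ~ J 1 ->
  exists f, ~ J f /\ forall g, mm g -> J (g * f).
Proof.
move=> J_id tail_J nJ1.
suff step e : fps_tail e `<=` J ->
    exists f, ~ J f /\ forall g, mm g -> J (g * f) by exact: (step d).
elim: e => [|e IHe] tail_eJ; first by case: nJ1; apply: tail_eJ.
have [/IHe //|/existsNP[f /not_implyP[tail_f nJf]]] := pselect (fps_tail e `<=` J).
by exists f; split=> // g g0; apply: tail_eJ; exact: fps_maxM_tail.
Qed.

(** Induction on the codimension: adding a socle element to [J] gives an ideal [J'] of rank one
    more, and [J] is put in front of a chain that starts at [J']. *)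
Lemma ideal_chain_ex J (M : 'M[k]_D) : is_ideal J -> fps_tail d `<=` J ->
  (forall f, J f <-> (vec f <= M)%MS) -> quot_chain J (D - \rank M).
Proof.
move eq_c : (D - \rank M)%N => c.
elim: c J M eq_c => [|c IHc] J M eq_c J_id tail_J eq_M.
  by exists (fun=> J); split=> [i _|i]; [split | rewrite ltn0].
have [f [nJf mJf]] : exists f, ~ J f /\ forall g, mm g -> J (g * f).
  apply: ideal_step => // J1; suff : (D <= \rank M)%N by rewrite -subn_eq0 eq_c.
  rewrite -{1}(mxrank1 k D); apply: mxrankS; apply/row_subP => i.
  have [g <-] := vec_onto (row i 1%:M); apply/eq_M.
  by have [_ _ JM] := J_id; rewrite -[g]mulr1; exact: JM.
have [J0 JD JM] := J_id.
pose J' : set R := [set g | exists c, J (g - c *: f)].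
have sub_J' : J `<=` J' by move=> g Jg; exists 0; rewrite scale0r subr0.
have J'_id : is_ideal J'.
  split=> [|x y [a Ja] [b Jb]|r x [a Ja]]; first exact: sub_J'.
    by exists (a + b); rewrite scalerDl opprD addrACA; exact: JD.
  (* Modulo [J], a series [r] acts on [f] through its constant term, because [r - r(0)] lies in
     m. *)
  exists (a * r 0%MM).
  rewrite -(subrK (r * (a *: f)) (r * x)) -mulrBr -addrA; apply: JD; first exact: JM.
  have -> : r * (a *: f) - (a * r 0%MM) *: f = a *: ((r - r 0%MM *: (1 : R)) * f : R).
    rewrite mulrC -fps_scaleAl mulrBl scalerBr -fps_scaleAl mul1r scalerA.
    by rewrite [f * r]mulrC.
  apply: idealZ => //; apply: mJf; rewrite /fps_max /=.
  by rewrite eqxx mulr1 subrr.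
have eq_M' g : J' g <-> (vec g <= (vec f + M)%MS)%MS.
  split=> [[a Ja]|/sub_addsmxP[[u w] /= eq_g]].
    rewrite -(subrK (a *: f) g) vec_fpsD vec_fpsZ addrC.
    apply: addmx_sub_adds; first exact: scalemx_sub.
    by apply/eq_M.
  exists (u 0 0); apply/eq_M; rewrite -scaleNr vec_fpsD vec_fpsZ eq_g.
  by rewrite {1}[u]mx11_scalar mul_scalar_mx addrAC scaleNr subrr add0r submxMl.
have [|C [C_id C_lt]] := IHc J' _ _ J'_id (subset_trans tail_J sub_J') eq_M'.
  rewrite mxrank_adds_row; last by apply/negP => /eq_M.
  by rewrite subnS eq_c.
exists (fun i => if i is i'.+1 then C i' else J); split=> [[_|i le_ic]|[|i]] //.
- by split.
- have [Ci sub_C] := C_id i le_ic; split=> //; exact: subset_trans sub_J' sub_C.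
- move=> _; have [_ sub_C] := C_id 0%N isT; split; first exact: subset_trans sub_J' sub_C.
  move=> /(_ f) C0f; apply/nJf/C0f/sub_C.
  by exists 1; rewrite scale1r subrr.
by move=> /C_lt.
Qed.

Lemma quot_length_mx J (M : 'M[k]_D) l : is_ideal J -> fps_tail d `<=` J ->
  (forall f, J f <-> (vec f <= M)%MS) -> quot_length J l <-> l = (D - \rank M)%N.
Proof.
move=> J_id tail_J eq_M.
have C_le l' := @ideal_chain_le J M l' tail_J eq_M.
have C_ex := ideal_chain_ex J_id tail_J eq_M.
split=> [[C_l max_l]|->]; last by split.
by apply/eqP; rewrite eqn_leq C_le // max_l.
Qed.

End Coordinates.

(** * Macaulay duality *)

Section Duality.
Context (k : fieldType) (n d : nat).
Local Notation R := (fps k n).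
Local Notation S := {mpoly k[n]}.
Local Notation mm := (@fps_max k n).
Local Notation D := #|{: 'X_{1..n < d}}|.
Local Notation vec := (@vec k n d).
Local Notation pvec := (@pvec k n d).
Local Notation mono := (@mono n d).
Implicit Types (f g : R) (F G : S) (m al : 'X_{1..n}) (I J : set R).

Lemma annihilator_ideal F : is_ideal (annihilator F).
Proof.
split=> [|f g|f g] /=.
- exact: contract0l.
- by move=> fF gF; rewrite /annihilator /= contractDl fF gF addr0.
by move=> gF; rewrite /annihilator /= contractM gF contract0r.
Qed.

(** For [F] of size at most [d], this is the matrix of [f |-> f o F] in monomial coordinates, and
    its row space is <F>. In [catalecticant0] the row of the monomial 1 is replaced by 0, so that
    the row space becomes m o F. *)
Definition catalecticant F : 'M[k]_D := \matrix_(i, j) F@_(mono i + mono j).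
Definition catalecticant0 F : 'M[k]_D :=
  \matrix_(i, j) if mono i == 0%MM then 0 else F@_(mono i + mono j).
Local Notation cat := catalecticant.
Local Notation cat0 := catalecticant0.

Lemma pvec_contract f F : (msize F <= d)%N -> pvec (contract f F) = vec f *m cat F.
Proof.
move=> le_Fd; apply/rowP => j; rewrite !mxE (mcoeff_contract _ _ le_Fd).
rewrite (@sum_mono n d _ (fun al => f al * F@_(al + mono j))).
by apply: eq_bigr => i _; rewrite !mxE.
Qed.

Lemma pvec_contract_max f F : (msize F <= d)%N -> mm f ->
  pvec (contract f F) = vec f *m cat0 F.
Proof.
move=> le_Fd f0; rewrite pvec_contract //; apply/rowP => j; rewrite !mxE.
apply: eq_bigr => i _; rewrite !mxE; case: eqP => // ->.
by rewrite f0 !mul0r.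
Qed.

Lemma sub_catP F (v : 'rV_D) : (msize F <= d)%N ->
  (v <= cat F)%MS <-> exists f, v = pvec (contract f F).
Proof.
move=> le_Fd; split=> [/submxP[u ->]|[f ->]].
  by have [f <-] := vec_onto u; exists f; rewrite pvec_contract.
by rewrite pvec_contract // submxMl.
Qed.

Lemma sub_cat0P F (v : 'rV_D) : (msize F <= d)%N ->
  (v <= cat0 F)%MS <-> exists2 f, mm f & v = pvec (contract f F).
Proof.
move=> le_Fd; split=> [/submxP[u ->]|[f f0 ->]]; last first.
  by rewrite pvec_contract_max // submxMl.
have [g <-] := vec_onto u.
(* The constant term of [g] can be erased, since it only multiplies the zero row. *)
exists (Fps (fun m => if m == 0%MM then 0 else g m)); first by rewrite /fps_max /= eqxx.
rewrite pvec_contract //; apply/rowP => j; rewrite !mxE.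
by apply: eq_bigr => i _; rewrite !mxE /=; case: eqP; rewrite ?mul0r ?mulr0.
Qed.

(** <F> is the sum of the line through [F] and m o F, and [F] is not in m o F because contraction by
    m lowers the size. *)
Lemma mxrank_cat F : (msize F <= d)%N -> F != 0 ->
  \rank (cat F) = (\rank (cat0 F)).+1.
Proof.
move=> le_Fd F_neq0; rewrite -(@mxrank_adds_row _ _ (pvec F)).
  apply/eqmx_rank/andP; split.
    apply/row_subP => i; have /(sub_catP _ le_Fd)[f ->] := row_sub i (cat F).
    have -> : f = f 0%MM *: (1 : R) + (f - f 0%MM *: (1 : R)) by rewrite addrC subrK.
    rewrite contractDl contractZl contract1 pvecD pvecZ.
    apply: addmx_sub_adds; first exact: scalemx_sub.
    apply/(sub_cat0P _ le_Fd); eexists; last reflexivity.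
    by rewrite /fps_max /= eqxx mulr1 subrr.
  rewrite addsmx_sub; apply/andP; split.
    by apply/(sub_catP _ le_Fd); exists 1; rewrite contract1.
  apply/row_subP => i; have /(sub_cat0P _ le_Fd)[f _ ->] := row_sub i (cat0 F).
  by apply/(sub_catP _ le_Fd); exists f.
apply/negP => /(sub_cat0P _ le_Fd)[f f0 /pvec_inj eq_F].
have := msize_contract_max f0 F_neq0.
by rewrite -eq_F ?ltnn // (leq_trans (msize_contract _ _)).
Qed.

(** R/Ann F is isomorphic to <F>: the annihilator is the kernel of the catalecticant, so its
    codimension is the rank. *)
Lemma quot_length_annihilator F l : (msize F <= d)%N ->
  quot_length (annihilator F) l <-> l = \rank (cat F).
Proof.
move=> le_Fd; rewrite (@quot_length_mx _ _ d _ (kermx (cat F))) //.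
- by rewrite mxrank_ker subKn ?rank_leq_row.
- exact: annihilator_ideal.
- by move=> f tail_f; exact: contract_tail le_Fd.
move=> f; rewrite (sameP sub_kermxP eqP) -pvec_contract // -(pvec0 k n d).
split=> [->//|/eqP/pvec_inj]; apply; rewrite ?msize0 //.
exact: leq_trans (msize_contract _ _) le_Fd.
Qed.

(** The Macaulay pairing of [f] and [G], the constant term of [f o G], is the dot product in
    monomial coordinates. *)
Lemma vec_mul_pvec f G : (msize G <= d)%N ->
  vec f *m (pvec G)^T = ((contract f G)@_0)%:M.
Proof.
move=> le_Gd; rewrite [LHS]mx11_scalar mxE (mcoeff_contract _ _ le_Gd).
rewrite (@sum_mono n d _ (fun al => f al * G@_(al + 0))); congr _%:M.
by apply: eq_bigr => i _; rewrite !mxE addm0.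
Qed.

(** * The inverse system of an ideal as an orthogonal complement *)

Section Perp.
Context (I : set R) (t : nat) (b : 'I_t -> S).
Hypotheses (I_id : is_ideal I) (tail_I : fps_tail d `<=` I).
Hypothesis b_basis : quot_basis (perp I) [set 0] b.

Lemma perp_contract f G : perp I G -> perp I (contract f G).
Proof.
by move=> IG g Ig; rewrite -contractM mulrC contractM IG // contract0r.
Qed.
Lemma perpD F G : perp I F -> perp I G -> perp I (F + G).
Proof. by move=> IF IG f If; rewrite contractDr IF // IG // addr0. Qed.
Lemma perp0 : perp I 0.
Proof. by move=> f _; exact: contract0r. Qed.
Lemma perpZ c G : perp I G -> perp I (c *: G).
Proof. by move=> IG f If; rewrite contractZr IG // scaler0. Qed.

Lemma msize_perp G : perp I G -> (msize G <= d)%N.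
Proof.
move=> IG; apply: msize_leP => m le_dm; rewrite -[m]addm0 -mcoeff_contractX IG ?mcoeff0 //.
apply: tail_I => al lt_al /=; case: eqP => // eq_al.
by rewrite -eq_al leqNgt lt_al in le_dm.
Qed.

(** Constant terms suffice because [I] is an ideal: the coefficient of [f o G] at [m] is the
    constant term of [(x^m f) o G]. *)
Lemma perp_pairing G : perp I G <->
  (msize G <= d)%N /\ forall f, I f -> vec f *m (pvec G)^T = 0.
Proof.
split=> [IG|[le_Gd G_orth] f If].
  have le_Gd := msize_perp IG; split=> // f If.
  by rewrite vec_mul_pvec // IG // mcoeff0 raddf0.
apply/mpolyP => m; rewrite mcoeff0 -[m]addm0 -mcoeff_contractX -contractM.
have /(congr1 (fun A : 'M_1 => A 0 0)) : vec (fpsX k m * f) *m (pvec G)^T = 0.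
  by apply: G_orth; have [_ _ IM] := I_id; exact: IM.
by rewrite vec_mul_pvec // !mxE eqxx mulr1n.
Qed.

Definition perp_mx : 'M[k]_(t, D) := \matrix_i pvec (b i).
Local Notation B := perp_mx.

Lemma sub_perp_mxP (v : 'rV_D) : (v <= B)%MS <-> exists2 G, perp I G & v = pvec G.
Proof.
have [Ib b_gen _] := b_basis.
have mulB (u : 'rV_t) : u *m B = pvec (\sum_i u 0 i *: b i).
  rewrite mulmx_sum_row pvec_sum; apply: eq_bigr => i _.
  by rewrite pvecZ rowK.
split=> [/submxP[u ->]|[G /b_gen [c /= eq_G] ->]].
  exists (\sum_i u 0 i *: b i) => //.
  by elim/big_ind: _ => [|x y|i _]; [exact: perp0 | exact: perpD | exact/perpZ].
rewrite -[G](subrK (\sum_i c i *: b i)) eq_G add0r.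
apply/submxP; exists (\row_i c i); rewrite mulB; congr (pvec _).
by apply: eq_bigr => i _; rewrite mxE.
Qed.

Lemma sub_perp_mx G : perp I G -> (pvec G <= B)%MS.
Proof. by move=> IG; apply/sub_perp_mxP; exists G. Qed.

Lemma perp_mx_free : row_free B.
Proof.
have [Ib _ b_free] := b_basis.
apply: inj_row_free => u uB0; apply/rowP => i; rewrite mxE.
apply: (b_free (u 0)); apply: pvec_inj (msize_perp _) _ _.
- by elim/big_ind: _ => [|x y|j _]; [exact: perp0 | exact: perpD | exact/perpZ].
- by rewrite msize0.
rewrite pvec0 -[RHS]uB0 mulmx_sum_row pvec_sum; apply: eq_bigr => j _.
by rewrite pvecZ rowK.
Qed.

Lemma mxrank_perp_mx : \rank B = t.
Proof. exact/eqP/perp_mx_free. Qed.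

Lemma ideal_mul_perp (M : 'M[k]_D) : (forall f, (vec f <= M)%MS -> I f) -> B *m M^T = 0.
Proof.
move=> M_sub; apply/row_matrixP => i.
have /sub_perp_mxP[G /perp_pairing[_ G_orth] eq_G] := row_sub i B.
rewrite row_mul row0 eq_G; apply: trmx_inj; rewrite trmx_mul trmxK trmx0.
apply/row_matrixP => j; rewrite row_mul row0.
have [f eq_f] := vec_onto (row j M); rewrite -eq_f; apply: G_orth.
by apply: M_sub; rewrite eq_f row_sub.
Qed.

(** The rows of [B] span the orthogonal complement of the row space of [M], that is, the kernel of
    [M^T]. *)
Lemma mxrank_ideal (M : 'M[k]_D) : (forall f, I f <-> (vec f <= M)%MS) ->
  t = (D - \rank M)%N.
Proof.
move=> eq_M; rewrite -mxrank_perp_mx -(mxrank_tr M) -mxrank_ker.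
apply/eqmx_rank/andP; split.
  by apply/sub_kermxP/ideal_mul_perp => f /eq_M.
apply/row_subP => i; have [G le_Gd eq_G] := pvec_onto (row i (kermx M^T)).
rewrite -eq_G; apply: sub_perp_mx; apply/perp_pairing; split=> // f /eq_M/submxP[u ->].
rewrite eq_G -mulmxA -[M in _ *m (M *m _)]trmxK -trmx_mul -row_mul mulmx_ker.
by rewrite row0 trmx0 mulmx0.
Qed.

(** Double annihilator: the coordinates of [I] lie in the orthogonal complement of [B], and the two
    spaces have the same dimension by [mxrank_ideal]. *)
Lemma perp_perp f : (forall G, perp I G -> contract f G = 0) -> I f.
Proof.
move=> f_ann; have [M eq_M] := ideal_mx I_id tail_I.
have sub_M : (M <= kermx B^T)%MS.
  apply/sub_kermxP/trmx_inj; rewrite trmx_mul trmxK trmx0.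
  by apply: ideal_mul_perp => g /eq_M.
apply/eq_M; apply: (@submx_trans _ _ _ _ _ _ (kermx B^T)).
  apply/sub_kermxP/trmx_inj; rewrite trmx_mul trmxK trmx0.
  apply/row_matrixP => i; rewrite row_mul row0 rowK.
  have [Ib _ _] := b_basis.
  apply: trmx_inj; rewrite trmx_mul trmxK trmx0 vec_mul_pvec ?msize_perp //.
  by rewrite f_ann // mcoeff0 raddf0.
rewrite -(mxrank_leqif_sup sub_M) mxrank_ker mxrank_tr mxrank_perp_mx.
by rewrite (mxrank_ideal eq_M) subKn ?rank_leq_row.
Qed.

Lemma quot_length_ideal l : quot_length I l <-> l = t.
Proof.
have [M eq_M] := ideal_mx I_id tail_I.
by rewrite (mxrank_ideal eq_M); exact: quot_length_mx.
Qed.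

Lemma cover_colength_mx F c : (msize F <= d)%N ->
  cover_colength I F c <-> \rank (cat F) = (t + c)%N.
Proof.
move=> le_Fd; split=> [[l [/quot_length_ideal -> /quot_length_annihilator]]|rk_F].
  by move=> /(_ le_Fd).
exists t; split; first exact/quot_length_ideal.
exact/quot_length_annihilator.
Qed.

Lemma gor_cover_mx F : (msize F <= d)%N -> gor_cover I F <-> (B <= cat F)%MS.
Proof.
move=> le_Fd; split=> [cov_F|sub_B G IG].
  apply/row_subP => i; have /sub_perp_mxP[G /cov_F[f _ <-] ->] := row_sub i B.
  by apply/sub_catP => //; exists f.
have /(sub_catP _ le_Fd)[f eq_G] := submx_trans (sub_perp_mx IG) sub_B.
exists f => //; apply: pvec_inj (esym eq_G); last exact: msize_perp.
exact: leq_trans (msize_contract _ _) le_Fd.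
Qed.

Lemma colength1_cover_mx F : (msize F <= d)%N -> (0 < t)%N ->
  (gor_cover I F /\ cover_colength I F 1) <-> (B == cat0 F)%MS.
Proof.
move=> le_Fd t_gt0; rewrite gor_cover_mx // cover_colength_mx // addn1.
split=> [[sub_B rk_F]|eq_B].
  have F_neq0 : F != 0.
    apply/eqP => F0; suff cat0 : cat F = 0 by rewrite cat0 mxrank0 in rk_F.
    by apply/matrixP => i j; rewrite !mxE F0 mcoeff0.
  (* m o F has dimension [t], so inclusion of the perp of I in m o F is enough for equality. *)
  move: rk_F; rewrite mxrank_cat // => -[rk_F].
  have sub_B0 : (B <= cat0 F)%MS.
    apply/row_subP => i; have /sub_perp_mxP[G IG eq_G] := row_sub i B.
    have /(sub_catP _ le_Fd)[f eq_f] := submx_trans (row_sub i B) sub_B.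
    have [f0|f0_neq0] := eqVneq (f 0%MM) 0.
      by apply/sub_cat0P => //; exists f.
    (* Otherwise f is a unit and F would lie in the perp of I, so <F> would be
       too small. *)
    suff IF : perp I F.
      have : (cat F <= B)%MS.
        apply/row_subP => j; have /(sub_catP _ le_Fd)[g ->] := row_sub j (cat F).
        exact/sub_perp_mx/perp_contract.
      by move=> /mxrankS; rewrite mxrank_cat // rk_F mxrank_perp_mx ltnn.
    (* With this [g], the difference [F - g o F] is a scalar multiple of [f o F = G], which lies in
       the perp of I. *)
    pose g : R := 1 - (f 0%MM)^-1 *: f.
    apply: (@contract_nakayama _ _ (perp I) g).
    - exact: perpD.
    - exact: perp0.
    - by move=> ? ?; exact: perp_contract.
    - by rewrite /fps_max /= eqxx mulVf ?subrr.
    rewrite /g contractDl contract1 contractNl contractZl opprD opprK addrA subrr add0r.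
    apply: perpZ; suff -> : contract f F = G by [].
    apply: (@pvec_inj _ _ d); last by rewrite -eq_f.
      exact: leq_trans (msize_contract _ _) le_Fd.
    exact: msize_perp.
  by rewrite -(mxrank_leqif_eq sub_B0) mxrank_perp_mx rk_F.
have rk_F0 : \rank (cat0 F) = t by rewrite -(eqmx_rank eq_B) mxrank_perp_mx.
(* Positivity of [t] excludes [F = 0], for which m o F would be zero as well. *)
have F_neq0 : F != 0.
  apply/eqP => F0; suff cat0 : cat0 F = 0 by rewrite -rk_F0 cat0 mxrank0 in t_gt0.
  by apply/matrixP => i j; rewrite !mxE F0 mcoeff0 if_same.
split; last by rewrite mxrank_cat // rk_F0.
apply/row_subP => i; have /andP[sub_B _] := eq_B.
have /(sub_cat0P _ le_Fd)[f _ ->] := submx_trans (row_sub i B) sub_B.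
by apply/sub_catP => //; exists f.
Qed.

End Perp.
End Duality.

(** * Covers of colength at most 1 *)

Section Covers.
Context (k : fieldType) (n : nat) (I : set (fps k n)) (s t : nat).
Context (b : 'I_t -> {mpoly k[n]}).
Local Notation R := (fps k n).
Local Notation S := {mpoly k[n]}.
Local Notation mm := (@fps_max k n).
Implicit Types (f g : R) (F G : S) (m al : 'X_{1..n}).
Hypotheses (I_id : is_ideal I) (tail_I : fps_tail s.+1 `<=` I) (nI1 : ~ I 1).
Hypothesis b_basis : quot_basis (perp I) [set 0] b.

(** If the perp of I were zero, 1 would annihilate it and so belong to [I]. *)
Lemma perp_basis_gt0 : (0 < t)%N.
Proof.
rewrite lt0n; apply/eqP => t0; apply: nI1.
apply: (perp_perp I_id tail_I b_basis) => G IG; rewrite contract1.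
have [_ /(_ G IG) [c /= eq_G] _] := b_basis.
rewrite -eq_G big1 ?subr0 // => i.
by have := leq_trans (ltn_ord i) (eq_leq t0); rewrite ltn0.
Qed.

Lemma fps_maxMr f g : mm f -> mm (f * g).
Proof.
move=> f0; apply: (@fps_maxM_tail _ _ 0) => //.
by rewrite mdeg0.
Qed.

Lemma perp_mx_cat0P d F : fps_tail d `<=` I -> (msize F <= d)%N ->
  (perp_mx d b == catalecticant0 d F)%MS <->
  perp I = [set contract f F | f in mm].
Proof.
move=> tail_dI le_Fd.
have le_cF f : (msize (contract f F) <= d)%N.
  exact: leq_trans (msize_contract _ _) le_Fd.
have subP := @sub_perp_mxP _ _ d _ _ _ b_basis.
split=> [/andP[sub_B sub_c]|eq_perp].
  apply/seteqP; split=> [G IG|_ [f f0 <-]].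
    have /(sub_cat0P _ le_Fd)[f f0 eq_G] :=
      submx_trans (sub_perp_mx d b_basis IG) sub_B.
    exists f => //; apply: (pvec_inj _ _ (esym eq_G)) => //.
    exact: (msize_perp tail_dI).
  have /subP[G IG eq_G] : (pvec d (contract f F) <= perp_mx d b)%MS.
    by apply: submx_trans sub_c; apply/sub_cat0P => //; exists f.
  suff -> : contract f F = G by [].
  by apply: (pvec_inj _ _ eq_G) => //; exact: (msize_perp tail_dI).
apply/andP; split; apply/row_subP => i.
  have /subP[G] := row_sub i (perp_mx d b).
  rewrite eq_perp => -[f f0 <-] ->.
  by apply/sub_cat0P => //; exists f.
have /(sub_cat0P _ le_Fd)[f f0 ->] := row_sub i (catalecticant0 d F).
by apply: (sub_perp_mx d b_basis); rewrite eq_perp; exists f.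
Qed.

Lemma colength1_coverP F :
  gor_cover I F /\ cover_colength I F 1 <->
  perp I = [set contract f F | f in mm].
Proof.
(* [F] is arbitrary here: [d] must bound its size and also be large enough for m^d to lie in [I]. *)
pose d := maxn s.+1 (msize F).
have le_Fd : (msize F <= d)%N by rewrite leq_maxr.
have tail_dI : fps_tail d `<=` I.
  by apply: subset_trans tail_I; apply: fps_tail_le; rewrite leq_maxl.
rewrite -(perp_mx_cat0P tail_dI le_Fd).
exact: colength1_cover_mx perp_basis_gt0.
Qed.

(** Used to replace an arbitrary cover by the representative of its class of the form sum_j a_j
    F_j. *)
Lemma colength1_cover_shift F H : perp I H ->
  perp I = [set contract f F | f in mm] ->
  perp I = [set contract f (F - H) | f in mm].
Proof.
move=> IH eq_F; have := IH; rewrite {1}eq_F => -[g g0 eq_H].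
(* H = g o F with g in m, so F - H = (1 - g) o F generates <F>. *)
have [u _ eq_u] : cyclic_sub (F - H) F.
  apply: (@contract_nakayama _ _ (cyclic_sub (F - H)) g) => //.
  - move=> _ _ [x _ <-] [y _ <-]; exists (x + y) => //; exact: contractDl.
  - by exists 0 => //; exact: contract0l.
  - by move=> f _ [x _ <-]; exists (f * x) => //; exact: contractM.
  by rewrite eq_H; exists 1 => //; exact: contract1.
apply/seteqP; split=> [G|_ [f f0 <-]].
  rewrite {1}eq_F => -[f f0 <-]; exists (f * u); first exact: fps_maxMr.
  by rewrite contractM eq_u.
rewrite contractDr contractNr; apply: perpD.
  by rewrite eq_F; exists f.
by rewrite -scaleN1r; apply/perpZ/perp_contract.
Qed.

(** A monomial of degree at least s+2 in [G] would, after contraction by one of its variables, leave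
    one of degree at least s+1 in the perp of I. *)
Lemma msize_integral G : integral mm (perp I) G -> (msize G <= s.+2)%N.
Proof.
move=> int_G; apply: msize_leP => m le_m.
have [i [m' [eq_m eq_m']]] := mdegS_decomp (esym (prednK (leq_trans (ltn0Sn _) le_m))).
rewrite eq_m -mcoeff_contractX mcoeff_ge_msize // eq_m'.
apply: (leq_trans (msize_perp tail_I (int_G _ _))); last first.
  by move: le_m; case: (mdeg m).
by rewrite /fps_max /= eq_sym mnm1_eq0.
Qed.

Lemma gorenstein_cyclic_perp F : perp I = cyclic_sub F -> gorenstein I.
Proof.
move=> eq_F.
have IF : perp I F by rewrite eq_F; exists 1 => //; exact: contract1.
have I_ann f : contract f F = 0 -> I f.
  move=> fF0; apply: (perp_perp I_id tail_I b_basis) => G.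
  by rewrite eq_F => -[g _ <-]; rewrite -contractM mulrC contractM fF0 contract0r.
have F_neq0 : F != 0.
  by apply/eqP => F0; apply/nI1/I_ann; rewrite F0 contract0r.
pose al := mlead F; have lead_al : msize F = (mdeg al).+1 by rewrite mlead_deg.
have c_neq0 : F@_al != 0 by rewrite mleadc_eq0.
(* This represents the socle generator: [al] has top degree in [F], so contraction by [x^al] leaves
   only the leading coefficient. *)
pose f0 : R := (F@_al)^-1 *: fpsX k al.
have f0F : contract f0 F = 1.
  apply/mpolyP => m; rewrite contractZl mcoeffZ mcoeff_contractX mcoeff1.
  have [->|m_neq0] := eqVneq m 0%MM; first by rewrite addm0 mulVf.
  rewrite mcoeff_ge_msize ?mulr0 // lead_al mdegD -addn1 leq_add2l lt0n.
  by rewrite mdeg_eq0.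
exists (fun=> f0); split=> [_ y y0|x colon_x|c Ic i].
- apply: I_ann; rewrite mulrC contractM f0F; apply: (@contract_tail _ _ 1).
    move=> m; rewrite ltnS leqn0 mdeg_eq0 => /eqP ->; exact: y0.
  by rewrite msize1.
(* If m x lies in I then m kills [x o F], which is therefore a constant; its value is the coordinate
   of [x] along [f0]. *)
- exists (fun=> (contract x F)@_0); rewrite big_ord1; apply: I_ann.
  rewrite contractDl contractNl contractZl f0F; apply/eqP; rewrite subr_eq0; apply/eqP.
  apply/mpolyP => m; rewrite mcoeffZ mcoeff1.
  have [->|m_neq0] := eqVneq m 0%MM; first by rewrite mulr1.
  rewrite mulr0 -[m]addm0 -mcoeff_contractX -contractM mulrC IF ?mcoeff0 //.
  by apply: colon_x; rewrite /fps_max /= eq_sym (negbTE m_neq0).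
have := IF _ Ic; rewrite big_ord1 contractZl f0F => /(congr1 (mcoeff 0%MM)).
by rewrite mcoeffZ mcoeff1 eqxx mulr1 mcoeff0 (ord1 i).
Qed.

(** Colength 0 makes the dimensions of <F> and the perp of I equal, so the inclusion between them is
    an equality. *)
Lemma gorenstein_colength0 F :
  gor_cover I F -> cover_colength I F 0 -> gorenstein I.
Proof.
move=> cov_F; pose d := maxn s.+1 (msize F).
have le_Fd : (msize F <= d)%N by rewrite leq_maxr.
have tail_dI : fps_tail d `<=` I.
  by apply: subset_trans tail_I; apply: fps_tail_le; rewrite leq_maxl.
move=> /(cover_colength_mx I_id tail_dI b_basis _ le_Fd); rewrite addn0 => rk_F.
have sub_B := (gor_cover_mx tail_dI b_basis le_Fd).1 cov_F.
apply: (@gorenstein_cyclic_perp F); apply/seteqP; split=> // _ [f _ <-].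
have : (pvec d (contract f F) <= perp_mx d b)%MS.
  apply: (@submx_trans _ _ _ _ _ _ (catalecticant d F)).
    by apply/sub_catP => //; exists f.
  by rewrite -(mxrank_leqif_sup sub_B) rk_F (mxrank_perp_mx tail_dI b_basis).
move=> /(@sub_perp_mxP _ _ d _ _ _ b_basis)[G IG eq_G].
suff -> : contract f F = G by [].
apply: (pvec_inj _ _ eq_G); last exact: (msize_perp tail_dI).
exact: leq_trans (msize_contract _ _) le_Fd.
Qed.

End Covers.

(** * Minors *)

(** Reduction modulo [N] recovers the lowest digit. This keeps distinct monomials apart under
    Kronecker substitution. *)
Lemma digits_inj N h (u v : 'I_h -> nat) :
  (forall i, u i < N)%N -> (forall i, v i < N)%N ->
  (\sum_i u i * N ^ i = \sum_i v i * N ^ i)%N -> u =1 v.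
Proof.
elim: h u v => [|h IHh] u v u_lt v_lt; first by move=> _ [].
rewrite !big_ord_recl !expn0 !muln1.
have shift (w : 'I_h.+1 -> nat) :
    (\sum_(i < h) w (lift ord0 i) * N ^ lift ord0 i =
     (\sum_(i < h) w (lift ord0 i) * N ^ i) * N)%N.
  by rewrite big_distrl; apply: eq_bigr => i _; rewrite /= /bump expnSr mulnA.
rewrite !shift => eq_uv.
have N_gt0 : (0 < N)%N by apply: leq_ltn_trans (u_lt ord0).
have eq0 : u ord0 = v ord0.
  have := congr1 (modn^~ N) eq_uv.
  by rewrite addnC modnMDl addnC modnMDl !modn_small.
have eq_lift : (fun i => u (lift ord0 i)) =1 (fun i => v (lift ord0 i)).
  apply: IHh => //.
  move: eq_uv; rewrite eq0 => /addnI /eqP; rewrite eqn_pmul2r // => /eqP.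
  exact.
by move=> i; case: (unliftP ord0 i) => [j ->|->].
Qed.

(* Kronecker substitution x_i := x^(N^i), with N larger than every exponent. *)
Lemma mpoly_nonroot (K : closedFieldType) h (p : {mpoly K[h]}) :
  p != 0 -> exists a : 'rV[K]_h, p.@[a 0] != 0.
Proof.
move=> p_neq0; pose N := (msize p).+1.
pose wt (m : 'X_{1..h}) := (\sum_i m i * N ^ i)%N.
pose q : {poly K} := \sum_(m <- msupp p) p@_m *: 'X^(wt m).
have small (m : 'X_{1..h}) : m \in msupp p -> forall i, (m i < N)%N.
  move=> /msize_mdeg_lt lt_m i; apply: leq_ltn_trans (leq_trans lt_m (leqnSn _)).
  by rewrite mdegE (bigD1 i) //= leq_addr.
have q_neq0 : q != 0.
  have lead_in := mlead_supp p_neq0.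
  (* No other exponent of [p] has the weight of the leading one, so the leading coefficient of [p]
     survives in [q]. *)
  apply/eqP => /(congr1 (fun q : {poly K} => q`_(wt (mlead p)))) /eqP.
  rewrite coef0 coef_sum (bigD1_seq (mlead p)) ?msupp_uniq //=.
  rewrite coefZ coefXn eqxx mulr1 big_seq_cond big1 ?addr0 ?mleadc_eq0 ?(negbTE p_neq0) //.
  move=> m /andP[m_in ne_m]; rewrite coefZ coefXn; case: eqP => [eq_wt|_]; last by rewrite mulr0.
  case/eqP: ne_m; apply/mnmP; apply: (@digits_inj N) => //; exact: small.
have /closed_nonrootP[x] := q_neq0; rewrite /root => q_x.
exists (\row_i x ^+ (N ^ i)); apply: contraNneq q_x => p_x.
apply/eqP; rewrite -p_x mevalE /q horner_sum.
apply: eq_bigr => m _; rewrite hornerZ hornerXn; congr (_ * _).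
rewrite /wt expr_sum; apply: eq_bigr => i _.
by rewrite mxE -exprM mulnC.
Qed.

Section Minors.
Context (k : fieldType) (n h s t : nat) (I : set (fps k n)).
Context (b : 'I_t -> {mpoly k[n]}) (F : 'I_h -> {mpoly k[n]}).
Context (mu : 'X_{1..n} -> 'I_t -> {mpoly k[h]}).
Local Notation mm := (@fps_max k n).
Hypothesis mu_coord : forall al, (1 <= mdeg al <= s.+1)%N ->
  contract (fpsX _ al) (generic_comb F) =
  \sum_(j < t) mu al j *: map_mpoly (@mpolyC h k) (b j).

Lemma contract_specialize (a : 'rV[k]_h) al : (1 <= mdeg al <= s.+1)%N ->
  contract (fpsX k al) (\sum_j a 0 j *: F j) = \sum_j (mu al j).@[a 0] *: b j.
Proof.
move=> /mu_coord eq_al; apply/mpolyP => m.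
have := congr1 (fun p : {mpoly {mpoly k[h]}[n]} => (p@_m).@[a 0]) eq_al.
rewrite !mcoeff_contractX /generic_comb !raddf_sum /=.
rewrite (eq_bigr (fun j => a 0 j * (F j)@_(al + m))); last first.
  by move=> j _; rewrite mcoeffZ mcoeff_map_mpoly mevalM mevalXU mevalC.
move=> eq_m; rewrite (eq_bigr (fun j => a 0 j * (F j)@_(al + m))); last first.
  by move=> j _; rewrite mcoeffZ.
rewrite eq_m; apply: eq_bigr => j _.
by rewrite !mcoeffZ mcoeff_map_mpoly mevalM mevalC.
Qed.

(** The matrix of m o F factors through the basis of the perp of I, with coefficient matrix [X]
    given by the values of [mu] at [a]. As [B] is row free, equality of the row spaces means that
    [X] has rank [t], i.e. that some minor of order [t] is nonzero. *)
Lemma perp_basis_minorP (a : 'rV[k]_h) : fps_tail s.+1 `<=` I ->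
  quot_basis (perp I) [set 0] b ->
  (perp_mx s.+2 b == catalecticant0 s.+2 (\sum_j a 0 j *: F j))%MS <->
  exists f, minors_ideal s.+1 mu f /\ f.@[a 0] != 0.
Proof.
move=> tail_I b_basis; set d := s.+2; set Fa := \sum_j _.
have tail_dI : fps_tail d `<=` I by apply: subset_trans tail_I; exact: fps_tail_le.
have B_free := perp_mx_free tail_dI b_basis.
(* With [d = s+2] the rows are the monomials of degree at most s+1; the row of the monomial 1 is set
   to 0, as in [catalecticant0]. *)
pose X := \matrix_(i, j) if (1 <= mdeg (@mono n d i))%N then (mu (mono i) j).@[a 0] else 0.
have -> : catalecticant0 d Fa = X *m perp_mx d b.
  apply/row_matrixP => i; rewrite row_mul mulmx_sum_row.
  apply/rowP => l; rewrite !mxE summxE -mdeg_eq0.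
  have [deg0|deg_gt0] := posnP (mdeg (mono i)).
    by rewrite big1 // => j _; rewrite !mxE deg0 mul0r.
  rewrite -mcoeff_contractX contract_specialize; last first.
    by have := mdeg_mono i; rewrite ltnS deg_gt0.
  by rewrite raddf_sum; apply: eq_bigr => j _; rewrite !mxE /= deg_gt0 mcoeffZ.
have -> : (perp_mx d b == X *m perp_mx d b)%MS = row_full X.
  rewrite submxMl andbT -(mxrank_leqif_sup (submxMl X (perp_mx d b))).
  by rewrite mxrankMfree // (eqP B_free).
have det_eval (r : 'I_t -> 'X_{1..n}) :
    (\det (\matrix_(i < t, j < t) mu (r i) j)).@[a 0] =
    \det (\matrix_(i < t, j < t) (mu (r i) j).@[a 0]).
  rewrite -det_map_mx; congr (\det _).
  by apply/matrixP => i j; rewrite !mxE.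
split=> [full_X|[f [[m [c [y [minor_y ->]]]]]]].
  pose r (i : 'I_t) := @mono n d (fullrankfun full_X i).
  have det_r : \det (rowsub (fullrankfun full_X) X) != 0.
    by rewrite -unitfE -unitmxE; exact: fullrowsub_unit.
  (* A nonzero minor cannot use the zero row of the monomial 1, so its rows are admissible in
     [minors_ideal]. *)
  have r_gt0 i : (1 <= mdeg (r i))%N.
    rewrite lt0n; apply: contraNneq det_r => r_i0.
    rewrite (expand_det_row _ i) big1 // => j _; rewrite !mxE.
    by rewrite -/(r i) r_i0 mul0r.
  exists (\det (\matrix_(i < t, j < t) mu (r i) j)); split.
    exists 1%N, (fun=> 1), (fun=> \det (\matrix_(i < t, j < t) mu (r i) j)).
    rewrite big_ord1 mul1r; split=> // _; exists r; split=> // [i j|i].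
      by move=> /mono_inj /fullrankfun_inj.
    by rewrite r_gt0; have := mdeg_mono (fullrankfun full_X i); rewrite ltnS.
  rewrite det_eval; suff -> : \matrix_(i, j) (mu (r i) j).@[a 0] =
    rowsub (fullrankfun full_X) X by [].
  by apply/matrixP => i j; rewrite !mxE -/(r i) r_gt0.
(* A combination of minors that is nonzero at [a] involves a minor that is nonzero at [a]; its rows
   are among those of [X]. *)
move=> f_a; have [i y_i] : exists i, (y i).@[a 0] != 0.
  apply: contrapT => /forallNP y0; case/negP: f_a; rewrite raddf_sum big1 ?eqxx // => i _ /=.
  by rewrite mevalM; have /negP := y0 i; rewrite negbK => /eqP ->; rewrite mulr0.
have [r [r_inj r_deg eq_y]] := minor_y i.
move: y_i; rewrite eq_y det_eval -unitfE -unitmxE -row_full_unit => full_r.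
have /choice[g eq_g] j : exists l, @mono n d l = r j.
  by apply: mono_onto; rewrite ltnS; case/andP: (r_deg j).
have eq_sub : \matrix_(i, j) (mu (r i) j).@[a 0] = rowsub g X.
  by apply/matrixP => j l; rewrite !mxE eq_g; case/andP: (r_deg j) => ->.
by rewrite -sub1mx; apply: submx_trans (rowsub_sub g X); rewrite -eq_sub sub1mx.
Qed.

End Minors.

(** * The locus of minimal covers and the criterion for colength 1 *)

Theorem theorem5p6 (k : closedFieldType) (n : nat) (I : set (fps k n))
    (s t h : nat) (b : 'I_t -> {mpoly k[n]}) (F : 'I_h -> {mpoly k[n]})
    (mu : 'X_{1..n} -> 'I_t -> {mpoly k[h]})
    (I_ideal : is_ideal I)
    (I_artin : artinian_quot I)
    (I_embdim : embdim I n)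
    (I_socdeg : socle_degree I s)
    (b_basis : quot_basis (perp I) [set 0] b)
    (F_basis : quot_basis (integral (@fps_max k n) (perp I)) (perp I) F)
    (mu_linear : forall al, (1 <= mdeg al <= s.+1)%N ->
       forall j, mu al j \is 1.-homog)
    (mu_coord : forall al, (1 <= mdeg al <= s.+1)%N ->
       contract (fpsX _ al) (generic_comb F) =
       \sum_(j < t) mu al j *: map_mpoly (@mpolyC h k) (b j)) :
  (is_gcl I 1 ->
     MGC I F = [set: proj k h] `\` Vplus (minors_ideal s.+1 mu)) /\
  (~ gorenstein I ->
     (is_gcl I 1 <-> minors_ideal s.+1 mu <> [set 0])).
Proof.
have tail_I := socle_degree_tail I_ideal I_socdeg.
have nI1 : ~ I 1.
  move=> I1; have [_ _ IM] := I_ideal; case: I_socdeg => + _; apply=> f _.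
  by rewrite -[f]mulr1; exact: IM.
pose Fa (a : 'rV[k]_h) := \sum_(j < h) a 0 j *: F j.
have [int_F int_gen _] := F_basis.
have int_Fa a : integral (@fps_max k n) (perp I) (Fa a).
  move=> f f0; rewrite contract_sumr; elim/big_ind: _ => [|x y|j _].
  - exact: perp0.
  - exact: perpD.
  by rewrite contractZr; apply/perpZ/int_F.
have coverP := colength1_coverP I_ideal tail_I nI1 b_basis.
(* Both sides express that the perp of I is m o F_a; the bound s+2 on the size of F_a comes from
   [msize_integral]. *)
have minorP a : gor_cover I (Fa a) /\ cover_colength I (Fa a) 1 <->
    exists f, minors_ideal s.+1 mu f /\ f.@[a 0] != 0.
  rewrite coverP -(perp_basis_minorP mu_coord a tail_I b_basis).
  apply: iff_sym; apply: (perp_mx_cat0P b_basis).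
    by apply: subset_trans tail_I; exact: fps_tail_le.
  exact: (msize_integral tail_I (int_Fa a)).
split=> [gcl1|nGor].
  apply/seteqP; split=> [P [a P_a [cov_a [c [col_a gcl_c]]]]|P [_ nV]].
    split=> // V_P; have eq_c1 : c = 1%N.
      have [[G [cov_G col_G]] min1] := gcl1.
      by apply/eqP; rewrite eqn_leq (gcl_c.2 _ _ cov_G col_G) (min1 _ _ cov_a col_a).
    have [f [J_f f_a]] := (minorP a).1 (conj cov_a (eq_ind _ _ col_a _ eq_c1)).
    by rewrite (V_P a P_a f J_f) eqxx in f_a.
  (* A point outside [Vplus] has a representative [a] at which some [f] in the ideal is nonzero, and
     [MGC] asks for a single representative. *)
  move: nV => /existsNP[a /not_implyP[P_a /existsNP[f /not_implyP[J_f /eqP f_a]]]].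
  have [cov_a col_a] := (minorP a).2 (ex_intro _ f (conj J_f f_a)).
  by exists a => //; split=> //; exists 1%N.
split=> [[[G [cov_G col_G]] _]|J_neq0].
  have eq_G := (coverP G).1 (conj cov_G col_G).
  have [a Ga] : exists a : 'I_h -> k, perp I (G - \sum_(j < h) a j *: F j).
    by apply: int_gen => f f0; rewrite eq_G; exists f.
  (* [G] differs from its representative by an element of the perp of I, so the representative is
     again a cover of colength 1. *)
  have eq_a : Fa (\row_j a j) = G - (G - \sum_(j < h) a j *: F j).
    by rewrite opprB addrC subrK; apply: eq_bigr => j _; rewrite mxE.
  have [f [J_f f_a]] : exists f,
      minors_ideal s.+1 mu f /\ f.@[(\row_j a j) 0] != 0.
    by apply/minorP/coverP; rewrite eq_a; exact: colength1_cover_shift.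
  by move=> J0; move: J_f f_a; rewrite J0 => ->; rewrite meval0 eqxx.
have [f J_f f_neq0] : exists2 f, minors_ideal s.+1 mu f & f != 0.
  apply: contrapT => no_f; apply: J_neq0; apply/seteqP; split=> [f J_f|_ ->] /=.
    by apply: contrapT => /eqP f_neq0; apply: no_f; exists f.
  (* The empty combination shows that 0 is in the ideal, so an ideal different from {0} has a
     nonzero element. *)
  by exists 0%N, (fun=> 0), (fun=> 0); split; [case | rewrite big_ord0].
have [a f_a] := mpoly_nonroot f_neq0.
split.
  by exists (Fa a); apply/minorP; exists f.
(* Minimality of 1 only has to exclude colength 0, which would make A Gorenstein. *)
move=> G [|d] // cov_G col_G; case: nGor.
exact: (gorenstein_colength0 I_ideal tail_I nI1 b_basis cov_G).
Qed.
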